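(* Let $X:\Omega\to\mathbb{C}^{N\times m}$ be a solution of the Grassmannian sigma model equations with associated surface $Z:\Omega\to\mathfrak{su}(N)$, and let $\det G\ne0$ on a neighborhood of a point of $\Omega$. On this neighborhood the second fundamental form and the mean curvature vector of the surface are $$\mathbf{II}=(\partial_L\partial_L Z-A^L_L\partial_L Z-A^L_R\partial_R Z)\,d\xi_L d\xi_L+2(\partial_L\partial_R Z)\,d\xi_L d\xi_R+(\partial_R\partial_R Z-A^R_L\partial_L Z-A^R_R\partial_R Z)\,d\xi_R d\xi_R,$$ $$\mathbf{H}=\frac{1}{\det G}\Big(J_R(\partial_L\partial_L Z-A^L_L\partial_L Z-A^L_R\partial_R Z)-2G_{LR}\,\partial_L\partial_R Z+J_L(\partial_R\partial_R Z-A^R_L\partial_L Z-A^R_R\partial_R Z)\Big),$$ where $$A^L_L=\frac{J_R(\partial_L\partial_L Z,\partial_L Z)-G_{LR}(\partial_L\partial_L Z,\partial_R Z)}{\det G},\qquad A^L_R=\frac{J_L(\partial_L\partial_L Z,\partial_R Z)-G_{LR}(\partial_L\partial_L Z,\partial_L Z)}{\det G},$$ $$A^R_R=\frac{J_L(\partial_R\partial_R Z,\partial_R Z)-G_{LR}(\partial_R\partial_R Z,\partial_L Z)}{\det G},\qquad A^R_L=\frac{J_R(\partial_R\partial_R Z,\partial_L Z)-G_{LR}(\partial_R\partial_R Z,\partial_R Z)}{\det G},$$ and, for $B,D\in\{L,R\}$ (no summation), $$(\partial_B\partial_B Z,\partial_D Z)=\left(\delta_{B,D}-\tfrac12\right)\operatorname{tr}\Big((\partial_B\partial_B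 X\,\partial_D X^\dagger+\partial_D X\,\partial_B\partial_B X^\dagger)P+2\,\partial_B X\,\partial_B X^\dagger\,(X\,\partial_D X^\dagger+\partial_D X\,X^\dagger)\Big).$$ Moreover, if $n_3,\ldots,n_{N^2-1}$ is an orthonormal basis of the normal space and $Q^L_j,H_j,Q^R_j$ denote the components along $n_j$ of $\partial_L\partial_L Z$, $\partial_L\partial_R Z$, $\partial_R\partial_R Z$ respectively, then (summing over $j$) $$\mathbf{II}=\big(Q^L_j\,d\xi_Ld\xi_L+2H_j\,d\xi_Ld\xi_R+Q^R_j\,d\xi_Rd\xi_R\big)n_j,\qquad \mathbf{H}=\frac{1}{\det G}\big(J_RQ^L_j-2G_{LR}H_j+J_LQ^R_j\big)n_j.$$
   Context: Let $m,n\ge 1$ and $N=m+n$. Let $\Omega\subset\mathbb{R}^2$ be open, connected and simply connected, with light-cone coordinates $\xi_L=\xi^0+\xi^1$, $\xi_R=\xi^0-\xi^1$, and write $\partial_L=\partial/\partial\xi_L$, $\partial_R=\partial/\partial\xi_R$. A dagger denotes the conjugate transpose; derivatives of $X^\dagger$ are written $\partial_D X^\dagger=\partial_D(X^\dagger)$, $\partial_B\partial_B X^\dagger=\partial_B\partial_B(X^\dagger)$. A smooth map $X:\Omega\to\mathbb{C}^{N\times m}$ with $X^\dagger X=\mathbf{1}_{m\times m}$ represents a map into the Grassmannian $G(m,n)=SU(N)/S(U(m)\times U(n))$. Put $P=\mathbf{1}-XX^\dagger$, an orthogonal projector. $X$ is called a solution of the Grassmannian sigma model (Euler--Lagrange)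 equations if $[\partial_L\partial_R P,P]=0$ on $\Omega$, equivalently $\partial_L[\partial_R P,P]+\partial_R[\partial_L P,P]=0$. The algebra $\mathfrak{su}(N)$ of traceless anti-Hermitian $N\times N$ matrices is equipped with the scalar product $(A,B)=-\frac12\operatorname{tr}(AB)$ and so identified with Euclidean space $\mathbb{R}^{N^2-1}$. For a solution $X$, the associated surface is the smooth map $Z:\Omega\to\mathfrak{su}(N)$, unique up to an additive constant, with $$\partial_L Z=[\partial_L P,P],\qquad \partial_R Z=-[\partial_R P,P].$$ The induced metric is $G=\begin{pmatrix}J_L&G_{LR}\\ G_{LR}&J_R\end{pmatrix}$ with $$J_D=(\partial_D Z,\partial_D Z)=\operatorname{tr}(\partial_D X\,\partial_D X^\dagger P)\ (D=L,R),\qquad G_{LR}=(\partial_L Z,\partial_R Z)=-\tfrac12\operatorname{tr}\big((\partial_L X\,\partial_R X^\dagger+\partial_R X\,\partial_L X^\dagger)P\big),$$ and $\det G=J_LJ_R-G_{LR}^2$. With $(\cdot)^\perp$ denoting the component normal to the surface (orthogonal to $\partial_L Z$ and $\partial_R Z$), the second fundamental form and mean curvature vector are by definition $$\mathbf{II}=(\partial_L\partial_L Z)^\perp d\xi_Ld\xi_L+2(\partial_L\partial_R Z)^\perp d\xi_Ld\xi_R+(\partial_R\partial_R Z)^\perp d\xi_Rd\xi_R,$$ $$\mathbf{H}=\frac{1}{\det G}\big(J_R(\partial_L\partial_L Z)^\perp-2G_{LR}(\partial_L\partial_R Z)^\perp+J_L(\partial_R\partial_R Z)^\perp\big)$$ (the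 trace of $\mathbf{II}$ with respect to the induced metric, with no factor $\tfrac12$). *)

(* Defs.v *)
From mathcomp Require Import all_boot all_order all_algebra.
From mathcomp Require Import all_classical all_reals all_analysis.
From mathcomp Require Import complex.

Set Implicit Arguments.
Unset Strict Implicit.
Unset Printing Implicit Defensive.

Import Order.TTheory GRing.Theory Num.Theory.
Import numFieldNormedType.Exports.

Local Open Scope classical_set_scope.
Local Open Scope complex_scope.
Local Open Scope sesquilinear_scope.
Local Open Scope ring_scope.

Definition simply_connected (R : realType) (T : topologicalType) (A : set T) :=
  forall g : R -> T,
    {within `[0, 1], continuous g} -> g @` `[0, 1] `<=` A -> g 0 = g 1 ->
  exists H : R * R -> T,
    [/\ {within `[0, 1] `*` `[0, 1], continuous H},
        H @` (`[0, 1] `*` `[0, 1]) `<=` A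
      & forall t : R, 0 <= t <= 1 ->
          [/\ H (t, 0) = g t, H (t, 1) = g 0, H (0, t) = g 0 & H (1, t) = g 0]].

(* A point of the plane is the row (xi^0, xi^1).  Light-cone indices are
   booleans. *)
Definition xL : bool := true.
Definition xR : bool := false.

(* d xi_L = d xi^0 + d xi^1 and d xi_R = d xi^0 - d xi^1, applied to a tangent
   vector. *)
Definition dxi (R : realType) (B : bool) (v : 'rV[R]_2) : R :=
  if B then v 0 0 + v 0 1 else v 0 0 - v 0 1.

(* The basis dual to (d xi_L, d xi_R): d/d xi_L = (d/d xi^0 + d/d xi^1) / 2 and
   d/d xi_R = (d/d xi^0 - d/d xi^1) / 2. *)
Definition lc_vec (R : realType) (B : bool) : 'rV[R]_2 :=
  \row_k (if (k == 0) || B then 2^-1 else - 2^-1).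

(* Partial derivative of a complex matrix-valued map, taken on the real and
   imaginary parts of the entries since the variables are real. *)
Definition pd (R : realType) (p q : nat) (B : bool)
    (F : 'rV[R]_2 -> 'M[R[i]]_(p, q)) (x : 'rV[R]_2) : 'M[R[i]]_(p, q) :=
  \matrix_(i, j)
    ('D_(lc_vec R B) (fun y => complex.Re (F y i j)) x +i*
     'D_(lc_vec R B) (fun y => complex.Im (F y i j)) x).

(* C^infinity on an open set: all iterated directional derivatives are
   differentiable. *)
Definition smooth_fun (R : realType) (A : set 'rV[R]_2) (f : 'rV[R]_2 -> R) :=
  forall (s : seq 'rV[R]_2) (x : 'rV[R]_2), A x ->
    differentiable (foldr (fun v (g : 'rV[R]_2 -> R) => 'D_v g) f s) x.

Definition smooth_mx (R : realType) (p q : nat) (A : set 'rV[R]_2)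
    (F : 'rV[R]_2 -> 'M[R[i]]_(p, q)) :=
  forall i j, smooth_fun A (fun y => complex.Re (F y i j)) /\
              smooth_fun A (fun y => complex.Im (F y i j)).

Definition commutator_mx (K : pzRingType) (N : nat) (A B : 'M[K]_N) : 'M[K]_N :=
  A *m B - B *m A.

Definition perp_proj (R : realType) (m n : nat) (X : 'rV[R]_2 -> 'M[R[i]]_(m + n, m))
    (x : 'rV[R]_2) : 'M[R[i]]_(m + n) := 1%:M - X x *m (X x)^t*.

Definition sigma_solution (R : realType) (m n : nat) (Omega : set 'rV[R]_2)
    (X : 'rV[R]_2 -> 'M[R[i]]_(m + n, m)) :=
  [/\ smooth_mx Omega X,
      forall x, Omega x -> (X x)^t* *m X x = 1%:M
    & forall x, Omega x ->
        commutator_mx (pd xL (pd xR (perp_proj X)) x) (perp_proj X x) = 0].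

Definition su (R : realType) (N : nat) : set 'M[R[i]]_N :=
  [set A | A^t* = - A /\ \tr A = 0].

Definition surface (R : realType) (m n : nat) (Omega : set 'rV[R]_2)
    (X : 'rV[R]_2 -> 'M[R[i]]_(m + n, m)) (Z : 'rV[R]_2 -> 'M[R[i]]_(m + n)) :=
  [/\ smooth_mx Omega Z,
      forall x, Omega x -> su (Z x),
      forall x, Omega x -> pd xL Z x = commutator_mx (pd xL (perp_proj X) x) (perp_proj X x)
    & forall x, Omega x ->
        pd xR Z x = - commutator_mx (pd xR (perp_proj X) x) (perp_proj X x)].

(* The real part makes the scalar product real-valued on all matrices; it
   changes nothing on su(N), see [sprodE]. *)
Definition sprod (R : realType) (N : nat) (A B : 'M[R[i]]_N) : R :=
  complex.Re (- 2^-1 * \tr (A *m B)).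

Lemma sprodE (R : realType) (N : nat) (A B : 'M[R[i]]_N) :
  su A -> su B -> (sprod A B)%:C = - 2^-1 * \tr (A *m B).
Proof.
move=> [hA _] [hB _].
have trJ : (\tr (A *m B))^* = \tr (A *m B).
  rewrite -[RHS]mxtrace_tr trmx_mul -[A in RHS]opprK -[B in RHS]opprK -hA -hB.
  rewrite !linearN /= mulNmx linearN opprK.
  rewrite mxtrace_mulC /mxtrace rmorph_sum; apply: eq_bigr => i _.
  rewrite !mxE rmorph_sum; apply: eq_bigr => j _.
  by rewrite !mxE rmorphM.
rewrite /sprod; set z := _ * _.
have zJ : z^* = z.
  rewrite /z rmorphM /= trJ; congr (_ * _).
  by rewrite rmorphN fmorphV rmorph_nat.
case: z zJ => a b /= [] /eqP; rewrite eq_sym -subr_eq0 opprK -mulr2n.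
by rewrite mulrn_eq0 /= => /eqP ->.
Qed.

Definition metric (R : realType) (N : nat) (Z : 'rV[R]_2 -> 'M[R[i]]_N)
    (B D : bool) (x : 'rV[R]_2) : R := sprod (pd B Z x) (pd D Z x).

Definition det_metric (R : realType) (N : nat) (Z : 'rV[R]_2 -> 'M[R[i]]_N)
    (x : 'rV[R]_2) : R :=
  metric Z xL xL x * metric Z xR xR x - metric Z xL xR x ^+ 2.

Definition normal_space (R : realType) (N : nat) (Z : 'rV[R]_2 -> 'M[R[i]]_N)
    (x : 'rV[R]_2) : set 'M[R[i]]_N :=
  [set W | su W /\ forall B : bool, sprod W (pd B Z x) = 0].

(* V^perp: the W in the normal space such that V - W is tangent to the surface.
   It exists and is unique when V and the tangent vectors lie in su(N). *)
Definition normal_part (R : realType) (N : nat) (Z : 'rV[R]_2 -> 'M[R[i]]_N)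
    (x : 'rV[R]_2) (V : 'M[R[i]]_N) : 'M[R[i]]_N :=
  xget 0 [set W | normal_space Z x W /\
    exists a b : R, V - W = a%:C *: pd xL Z x + b%:C *: pd xR Z x].

(* The second fundamental form at x, as a quadratic form in the tangent vector
   v of the parameter domain. *)
Definition second_form (R : realType) (N : nat) (Z : 'rV[R]_2 -> 'M[R[i]]_N)
    (x v : 'rV[R]_2) : 'M[R[i]]_N :=
  (dxi xL v ^+ 2)%:C *: normal_part Z x (pd xL (pd xL Z) x)
  + (2 * (dxi xL v * dxi xR v))%:C *: normal_part Z x (pd xL (pd xR Z) x)
  + (dxi xR v ^+ 2)%:C *: normal_part Z x (pd xR (pd xR Z) x).

Definition mean_curvature (R : realType) (N : nat)
    (Z : 'rV[R]_2 -> 'M[R[i]]_N) (x : 'rV[R]_2) : 'M[R[i]]_N :=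
  ((det_metric Z x)^-1)%:C *:
    ((metric Z xR xR x)%:C *: normal_part Z x (pd xL (pd xL Z) x)
     - (2 * metric Z xL xR x)%:C *: normal_part Z x (pd xL (pd xR Z) x)
     + (metric Z xL xL x)%:C *: normal_part Z x (pd xR (pd xR Z) x)).

Definition orthonormal_normal_basis (R : realType) (N k : nat)
    (Z : 'rV[R]_2 -> 'M[R[i]]_N) (x : 'rV[R]_2) (e : 'I_k -> 'M[R[i]]_N) :=
  [/\ forall j, normal_space Z x (e j),
      forall j l, sprod (e j) (e l) = (j == l)%:R
    & forall W, normal_space Z x W ->
        exists c : 'I_k -> R, W = \sum_j (c j)%:C *: e j].

(* Main.v *)
Require Import Defs.
From mathcomp Require Import all_boot all_order all_algebra.
From mathcomp Require Import all_classical all_reals all_analysis.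
From mathcomp Require Import complex ring.

Set Implicit Arguments.
Unset Strict Implicit.
Unset Printing Implicit Defensive.

Import Order.TTheory GRing.Theory Num.Theory.
Import numFieldNormedType.Exports.

Local Open Scope classical_set_scope.
Local Open Scope complex_scope.
Local Open Scope sesquilinear_scope.
Local Open Scope ring_scope.

(** Differentiating P^2 = P shows that the derivatives P_B are off-diagonal with
    respect to P, so that [P, [P_B, P]] = - P_B.  Since Z_B = s_B [P_B, P] with
    s_L = 1 and s_R = -1, one gets Z_BB = s_B [P_BB, P] and, by cyclicity of the
    trace, (Z_BB, Z_D) = s_B s_D tr (P_BB P_D) / 2, where s_B s_D / 2 is
    delta_BD - 1/2; the stated trace follows from X^dagger X = 1 and its
    derivative.  The field equation leaves Z_LR = [P_L, P_R], which commutes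
    with P and is therefore orthogonal to both off-diagonal Z_D: it is already
    normal.  The tangential parts of Z_LL and Z_RR come from Cramer's rule for
    the Gram matrix G. *)

(** * Light-cone derivatives *)

Lemma Re_mul (R : rcfType) (z w : R[i]) :
  complex.Re (z * w) = complex.Re z * complex.Re w - complex.Im z * complex.Im w.
Proof. by case: z w => [a b] [c d]. Qed.

Lemma Im_mul (R : rcfType) (z w : R[i]) :
  complex.Im (z * w) = complex.Re z * complex.Im w + complex.Im z * complex.Re w.
Proof. by case: z w => [a b] [c d]. Qed.

Lemma Re_add (R : rcfType) (z w : R[i]) :
  complex.Re (z + w) = complex.Re z + complex.Re w.
Proof. by case: z w => [a b] [c d]. Qed.

Lemma Im_add (R : rcfType) (z w : R[i]) :
  complex.Im (z + w) = complex.Im z + complex.Im w.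
Proof. by case: z w => [a b] [c d]. Qed.

(* [pd B F x] is a junk value where F is not differentiable; [has_pd B F x F']
   records differentiability together with the value. *)
Definition has_pd (R : realType) p q (B : bool) (F : 'rV[R]_2 -> 'M[R[i]]_(p, q))
    (x : 'rV[R]_2) (F' : 'M[R[i]]_(p, q)) :=
  forall i j,
    is_derive x (lc_vec R B) (fun y => complex.Re (F y i j)) (complex.Re (F' i j)) /\
    is_derive x (lc_vec R B) (fun y => complex.Im (F y i j)) (complex.Im (F' i j)).

Section Pd.
Variables (R : realType) (B : bool) (x : 'rV[R]_2).

Lemma has_pdE p q (F : 'rV[R]_2 -> 'M[R[i]]_(p, q)) F' :
  has_pd B F x F' -> pd B F x = F'.
Proof.
move=> h; apply/matrixP => i j; rewrite mxE; have [hr hi] := h i j.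
by rewrite (@derive_val _ _ _ _ _ _ _ hr) (@derive_val _ _ _ _ _ _ _ hi); case: (F' i j).
Qed.

Lemma has_pdP p q (F : 'rV[R]_2 -> 'M[R[i]]_(p, q)) F' :
  has_pd B F x F' -> has_pd B F x (pd B F x).
Proof. by move=> h; rewrite (has_pdE h). Qed.

(** A partial derivative depends only on the germ at [x]; this is what allows identities valid on an
    open set to be differentiated. *)
Lemma has_pd_near p q (F G : 'rV[R]_2 -> 'M[R[i]]_(p, q)) F' :
  (\near x, F x = G x) -> has_pd B F x F' -> has_pd B G x F'.
Proof.
move=> FG h i j; have [hr hi] := h i j.
by split; [apply: near_eq_is_derive hr | apply: near_eq_is_derive hi];
  apply: filterS FG => y ->.
Qed.

Lemma has_pd_cst p q (A : 'M[R[i]]_(p, q)) : has_pd B (fun=> A) x 0.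
Proof. by move=> i j; rewrite mxE /=; split; apply: is_derive_cst. Qed.

Lemma has_pdD p q (F G : 'rV[R]_2 -> 'M[R[i]]_(p, q)) F' G' :
  has_pd B F x F' -> has_pd B G x G' -> has_pd B (fun y => F y + G y) x (F' + G').
Proof.
move=> hF hG i j; have [[hr hi] [gr gi]] := (hF i j, hG i j); rewrite mxE.
split; rewrite raddfD /=.
  rewrite (_ : (fun y => _) = (fun y => complex.Re (F y i j)) + (fun y => complex.Re (G y i j))).
    exact: is_deriveD.
  by apply/funext => y; rewrite mxE raddfD.
rewrite (_ : (fun y => _) = (fun y => complex.Im (F y i j)) + (fun y => complex.Im (G y i j))).
  exact: is_deriveD.
by apply/funext => y; rewrite mxE raddfD.
Qed.

Lemma has_pdN p q (F : 'rV[R]_2 -> 'M[R[i]]_(p, q)) F' :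
  has_pd B F x F' -> has_pd B (fun y => - F y) x (- F').
Proof.
move=> hF i j; have [hr hi] := hF i j; rewrite mxE.
split; rewrite raddfN /=.
  rewrite (_ : (fun y => _) = - (fun y => complex.Re (F y i j))); first exact: is_deriveN.
  by apply/funext => y; rewrite mxE raddfN.
rewrite (_ : (fun y => _) = - (fun y => complex.Im (F y i j))); first exact: is_deriveN.
by apply/funext => y; rewrite mxE raddfN.
Qed.

Lemma has_pdB p q (F G : 'rV[R]_2 -> 'M[R[i]]_(p, q)) F' G' :
  has_pd B F x F' -> has_pd B G x G' -> has_pd B (fun y => F y - G y) x (F' - G').
Proof. by move=> hF /has_pdN; apply: has_pdD. Qed.

Lemma has_pd_trC p q (F : 'rV[R]_2 -> 'M[R[i]]_(p, q)) F' :
  has_pd B F x F' -> has_pd B (fun y => (F y)^t*) x (F'^t*).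
Proof.
have ReC (z : R[i]) : complex.Re z^* = complex.Re z by case: z.
have ImC (z : R[i]) : complex.Im z^* = - complex.Im z by case: z.
move=> hF i j; have [hr hi] := hF j i; rewrite !mxE; split.
  rewrite ReC (_ : (fun y => _) = (fun y => complex.Re (F y j i))) //.
  by apply/funext => y; rewrite !mxE ReC.
rewrite ImC (_ : (fun y => _) = - (fun y => complex.Im (F y j i))); first exact: is_deriveN.
by apply/funext => y; rewrite !mxE ImC.
Qed.

Lemma has_pdM p q r (F : 'rV[R]_2 -> 'M[R[i]]_(p, q))
    (G : 'rV[R]_2 -> 'M[R[i]]_(q, r)) F' G' :
  has_pd B F x F' -> has_pd B G x G' ->
  has_pd B (fun y => F y *m G y) x (F' *m G x + F x *m G').
Proof.
(* [is_deriveM] and the matrix product list the Leibniz terms in different orders; these two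
   identities reconcile them for the real and the imaginary part. *)
have regroup (a a' b b' c c' d d' : R) :
    a * b' + b * a' - (c * d' + d * c') = a' * b - c' * d + (a * b' - c * d').
  by ring.
have regroup' (a a' b b' c c' d d' : R) :
    a * b' + b * a' + (c * d' + d * c') = a' * b + c' * d + (a * b' + c * d').
  by ring.
move=> hF hG i j; split.
  have h k := is_deriveB (is_deriveM (hF i k).1 (hG k j).1)
                         (is_deriveM (hF i k).2 (hG k j).2).
  rewrite (_ : (fun y => _) = \sum_k
      ((fun y => complex.Re (F y i k)) * (fun y => complex.Re (G y k j))
       - (fun y => complex.Im (F y i k)) * (fun y => complex.Im (G y k j)))); last first.
    apply/funext => y; rewrite mxE raddf_sum fct_sumE.
    by apply: eq_bigr => k _ /=; rewrite Re_mul.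
  apply: (is_derive_eq (is_derive_sum h)).
  rewrite !mxE -big_split raddf_sum /=; apply: eq_bigr => k _.
  by rewrite Re_add !Re_mul /GRing.scale /=; exact: regroup.
have h k := is_deriveD (is_deriveM (hF i k).1 (hG k j).2)
                       (is_deriveM (hF i k).2 (hG k j).1).
rewrite (_ : (fun y => _) = \sum_k
    ((fun y => complex.Re (F y i k)) * (fun y => complex.Im (G y k j))
     + (fun y => complex.Im (F y i k)) * (fun y => complex.Re (G y k j)))); last first.
  apply/funext => y; rewrite mxE raddf_sum fct_sumE.
  by apply: eq_bigr => k _ /=; rewrite Im_mul.
apply: (is_derive_eq (is_derive_sum h)).
rewrite !mxE -big_split raddf_sum /=; apply: eq_bigr => k _.
by rewrite Im_add !Im_mul /GRing.scale /=; exact: regroup'.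
Qed.

(** The trace is wrapped as a 1 by 1 matrix because [has_pd] speaks of matrix-valued maps. *)
Lemma has_pd_tr p (F : 'rV[R]_2 -> 'M[R[i]]_p) F' :
  has_pd B F x F' -> has_pd B (fun y => (\tr (F y))%:M : 'M[R[i]]_1) x (\tr F')%:M.
Proof.
move=> hF i j; rewrite !ord1 !mxE !eqxx !mulr1n; split; rewrite raddf_sum.
  rewrite (_ : (fun y => _) = \sum_k (fun y => complex.Re (F y k k))).
    by apply: is_derive_sum => k; have [] := hF k k.
  by apply/funext => y; rewrite mxE eqxx mulr1n raddf_sum fct_sumE.
rewrite (_ : (fun y => _) = \sum_k (fun y => complex.Im (F y k k))).
  by apply: is_derive_sum => k; have [] := hF k k.
by apply/funext => y; rewrite mxE eqxx mulr1n raddf_sum fct_sumE.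
Qed.

End Pd.

(** * Derivatives of smooth maps and of maps into su(N) *)

Section Smooth.
Variables (R : realType) (A : set 'rV[R]_2) (p q : nat).
Implicit Type F : 'rV[R]_2 -> 'M[R[i]]_(p, q).

(** In [smooth_fun], [foldr] applies the last direction of the list first, so a further derivative
    of [f] amounts to appending [v] to the list. *)
Lemma smooth_fun_derive (f : 'rV[R]_2 -> R) v :
  smooth_fun A f -> smooth_fun A ('D_v f).
Proof. by move=> sf s x Ax; have := sf (rcons s v) x Ax; rewrite foldr_rcons. Qed.

Lemma smooth_mx_pd B F : smooth_mx A F -> smooth_mx A (pd B F).
Proof.
move=> sF i j; have [sr si] := sF i j; split.
  rewrite (_ : (fun y => _) = 'D_(lc_vec R B) (fun y => complex.Re (F y i j))).
    exact: smooth_fun_derive.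
  by apply/funext => y; rewrite mxE.
rewrite (_ : (fun y => _) = 'D_(lc_vec R B) (fun y => complex.Im (F y i j))).
  exact: smooth_fun_derive.
by apply/funext => y; rewrite mxE.
Qed.

Lemma smooth_mx_has_pd B F x : smooth_mx A F -> A x -> has_pd B F x (pd B F x).
Proof.
move=> sF Ax i j; have [sr si] := sF i j; rewrite mxE /=.
by split; apply: derivableP; apply: diff_derivable; [exact: (sr [::])|exact: (si [::])].
Qed.

End Smooth.

(** The equations defining su(N) are real-linear, so differentiating them gives the same equations
    for the derivative. *)
Lemma su_pd (R : realType) N (Z : 'rV[R]_2 -> 'M[R[i]]_N) B x Z' :
  (\near x, su (Z x)) -> has_pd B Z x Z' -> su Z'.
Proof.
move=> sZ hZ; split.
  rewrite -(has_pdE (has_pd_trC hZ)); apply: has_pdE.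
  apply: has_pd_near (has_pdN hZ); near=> y.
  by have [-> _] : su (Z y) by near: y.
have := has_pdE (has_pd_tr hZ).
rewrite (has_pdE (F' := 0)) => [/(congr1 (fun M : 'M[R[i]]_1 => M 0 0))|].
  by rewrite !mxE eqxx mulr1n.
apply: has_pd_near (has_pd_cst B x 0); near=> y.
have [_ ->] : su (Z y) by near: y.
by rewrite raddf0.
Unshelve. all: by end_near.
Qed.

(** * Projectors and their derivatives *)

Section Commutator.
Variables (K : comPzRingType) (N : nat).
Implicit Types A P D E : 'M[K]_N.

(** Sandwiching [D *m P + P *m D = D] between two copies of [P] gives PDP = PDP + PDP, and one copy
    cancels. *)
Lemma proj_der_sandwich P D :
  P *m P = P -> D *m P + P *m D = D -> P *m D *m P = 0.
Proof.
move=> PP dP; have : P *m D *m P = P *m D *m P + P *m D *m P.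
  by rewrite -{1}dP mulmxDr mulmxDl !mulmxA PP -(mulmxA _ P P) PP.
by rewrite -[X in X = _]addr0 => /addrI.
Qed.

(** The double commutator expands to 2 PDP - PD - DP. The sandwiched terms vanish and the rest is
    the Leibniz rule for P^2 = P. *)
Lemma commutator_mx2 P D : P *m P = P -> D *m P + P *m D = D ->
  commutator_mx P (commutator_mx D P) = - D.
Proof.
move=> PP dP; rewrite /commutator_mx mulmxBr mulmxBl !mulmxA PP.
rewrite -(mulmxA D) PP (proj_der_sandwich PP dP).
by rewrite sub0r subr0 -opprD addrC dP.
Qed.

(** Invariance of the trace form under the adjoint action. *)
Lemma tr_commutatorCA A P E :
  \tr (commutator_mx A P *m E) = \tr (A *m commutator_mx P E).
Proof.
rewrite /commutator_mx mulmxBl mulmxBr !linearB /= !mulmxA; congr (_ - _).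
by rewrite -mulmxA mxtrace_mulC.
Qed.

(** Invariance moves the first commutator onto the second, where the double commutator collapses.
    With [A] a second derivative of the projector, this evaluates (Z_BB, Z_D) up to its sign and the
    factor 1/2. *)
Lemma tr_commutator_proj A P D : P *m P = P -> D *m P + P *m D = D ->
  \tr (commutator_mx A P *m commutator_mx D P) = - \tr (A *m D).
Proof.
by move=> PP dP; rewrite tr_commutatorCA commutator_mx2 // mulmxN linearN.
Qed.

(* Derivatives of a projector P are off-diagonal with respect to P, so their
   products commute with P, whereas [D, P] is off-diagonal. *)
Lemma tr_commutator_der_proj P D1 D2 D :
  D1 *m P + P *m D1 = D1 -> D2 *m P + P *m D2 = D2 ->
  \tr (commutator_mx D1 D2 *m commutator_mx D P) = 0.
Proof.
(* An off-diagonal factor exchanges P and 1 - P, hence a product of two such factors commutes with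
   P: PAB = A(1 - P)B = ABP. *)
have PDD (A B : 'M[K]_N) : A *m P + P *m A = A -> B *m P + P *m B = B ->
    P *m (A *m B) = A *m B *m P.
  move=> dA dB; have -> : P *m (A *m B) = (A - A *m P) *m B.
    by rewrite -{2}dA addrAC subrr add0r mulmxA.
  have BP : B *m P = B - P *m B by rewrite -{2}dB addrK.
  by rewrite -[in RHS]mulmxA BP mulmxBl mulmxBr !mulmxA.
move=> d1 d2; set C := commutator_mx D1 D2.
have PC : P *m C = C *m P by rewrite /C /commutator_mx mulmxBr mulmxBl !PDD.
rewrite /commutator_mx mulmxBr linearB /= mulmxA mxtrace_mulC !mulmxA PC.
by rewrite subrr.
Qed.

End Commutator.

(* Y, YB, YD, YBB play the role of the adjoints of X and of its derivatives. *)
Lemma tr_perp_der2 (K : comPzRingType) (N m : nat)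
    (X XB XD XBB : 'M[K]_(N, m)) (Y YB YD YBB : 'M[K]_(m, N)) :
  Y *m X = 1%:M -> YD *m X + Y *m XD = 0 ->
  \tr ((XBB *m Y + XB *m YB + (XB *m YB + X *m YBB)) *m (XD *m Y + X *m YD)) =
  \tr ((XBB *m YD + XD *m YBB) *m (1%:M - X *m Y)
       + 2 *: (XB *m YB *m (X *m YD + XD *m Y))).
Proof.
move=> YX dYX.
have YXD : Y *m XD = - (YD *m X) by apply/eqP; rewrite -addr_eq0 addrC dYX.
have YDX : YD *m X = - (Y *m XD) by rewrite YXD opprK.
(* These are the four products containing a second derivative. [t2] and [t3] give the part of the
   trace with 1, [t1] and [t4] the part with - XY, of the projector 1 - XY. *)
have t1 : \tr (XBB *m Y *m (XD *m Y)) = - \tr (XBB *m YD *m (X *m Y)).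
  by rewrite -mulmxA (mulmxA Y) YXD mulNmx mulmxN linearN /= -!mulmxA.
have t2 : XBB *m Y *m (X *m YD) = XBB *m YD.
  by rewrite -mulmxA (mulmxA Y) YX mul1mx.
have t3 : \tr (X *m YBB *m (XD *m Y)) = \tr (XD *m YBB).
  by rewrite mxtrace_mulC -mulmxA (mulmxA Y) YX mul1mx.
have t4 : \tr (X *m YBB *m (X *m YD)) = - \tr (XD *m YBB *m (X *m Y)).
  rewrite mxtrace_mulC -(mulmxA X YD) (mulmxA YD) YDX mulNmx mulmxN linearN /=.
  congr (- _); have -> : X *m (Y *m XD *m YBB) = (X *m Y) *m (XD *m YBB).
    by rewrite !mulmxA.
  by rewrite mxtrace_mulC.
have -> (a b c d e : 'M[K]_N) : (a + b + (b + c)) *m (d + e) =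
    (a *m d + a *m e + (c *m d + c *m e)) + 2 *: (b *m (e + d)).
  rewrite scaler_nat mulr2n (addrC e) (addrC b c) addrACA !mulmxDl.
  by rewrite -!mulmxDr.
rewrite mulmxBr mulmx1 mulmxDl !linearD linearN /= t1 t2 t3 t4.
by rewrite [\tr (- _)]linearN /= (addrC (- _) (\tr (XBB *m YD))) (addrACA (\tr _)).
Qed.

(** * Normal parts *)

Section Cramer.
Variables (F : fieldType) (J G K : F).
Hypothesis det0 : J * K - G ^+ 2 != 0.

Lemma cramer2_uniq (c d : F) :
  c * J + d * G = 0 -> c * G + d * K = 0 -> c = 0 /\ d = 0.
Proof.
move=> h1 h2; split; apply: (mulIf det0); rewrite mul0r.
  have -> : c * (J * K - G ^+ 2) = (c * J + d * G) * K - (c * G + d * K) * G.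
    by ring.
  by rewrite h1 h2; ring.
have -> : d * (J * K - G ^+ 2) = (c * G + d * K) * J - (c * J + d * G) * G.
  by ring.
by rewrite h1 h2; ring.
Qed.

Lemma cramer2_sol (u v : F) :
  let a := (K * u - G * v) / (J * K - G ^+ 2) in
  let b := (J * v - G * u) / (J * K - G ^+ 2) in
  u - a * J - b * G = 0 /\ v - a * G - b * K = 0.
Proof. by move=> a b; rewrite /a /b; split; field. Qed.

End Cramer.

(** * The scalar product and the Gram determinant of two vectors *)

Section ScalarProduct.
Variables (R : realType) (N : nat).
Implicit Types (A B W : 'M[R[i]]_N) (c : R).

Lemma suB A B : su A -> su B -> su (A - B).
Proof.
move=> [hA tA] [hB tB]; split; last by rewrite linearB /= tA tB subrr.
by rewrite linearB /= map_mxB hA hB opprB opprK addrC.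
Qed.

Lemma suZ c A : su A -> su (c%:C *: A).
Proof.
move=> [hA tA]; split; last by rewrite linearZ /= tA mulr0.
apply/matrixP => i j; have /matrixP/(_ i j) := hA.
rewrite !mxE rmorphM /= => ->; rewrite mulrN; congr (- (_ * _)).
by apply/eqP; rewrite eq_complex /= oppr0 !eqxx.
Qed.

Lemma sprodC A B : sprod A B = sprod B A.
Proof. by rewrite /sprod mxtrace_mulC. Qed.

Lemma sprodDl A B W : sprod (A + B) W = sprod A W + sprod B W.
Proof. by rewrite /sprod mulmxDl linearD mulrDr Re_add. Qed.

Lemma sprodZl c A W : sprod (c%:C *: A) W = c * sprod A W.
Proof.
by rewrite /sprod -scalemxAl linearZ /= mulrCA Re_mul /= mul0r subr0.
Qed.

Lemma sprodNl A W : sprod (- A) W = - sprod A W.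
Proof. by rewrite /sprod mulNmx linearN mulrN raddfN. Qed.

Lemma sprodBl A B W : sprod (A - B) W = sprod A W - sprod B W.
Proof. by rewrite sprodDl sprodNl. Qed.

Lemma sprod0l W : sprod 0 W = 0.
Proof. by rewrite /sprod mul0mx linear0 mulr0. Qed.

Lemma sprod_suml k (F : 'I_k -> 'M[R[i]]_N) W :
  sprod (\sum_j F j) W = \sum_j sprod (F j) W.
Proof.
by elim/big_ind2 : _ => [|a b c d <- <-|//]; [exact: sprod0l|exact: sprodDl].
Qed.

Lemma sprod_residual A B W V (a b : R) : sprod W A = 0 -> sprod W B = 0 ->
  sprod (V - a%:C *: A - b%:C *: B) W = sprod V W.
Proof.
rewrite !sprodBl !sprodZl (sprodC A) (sprodC B) => -> ->.
by rewrite !mulr0 !subr0.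
Qed.

Lemma sprod_orthonormal k (e : 'I_k -> 'M[R[i]]_N) (c : 'I_k -> R) j :
  (forall j l, sprod (e j) (e l) = (j == l)%:R) ->
  sprod (\sum_l (c l)%:C *: e l) (e j) = c j.
Proof.
move=> oe; rewrite sprod_suml (bigD1 j) //= sprodZl oe eqxx mulr1.
by rewrite big1 ?addr0 // => l /negbTE lj; rewrite sprodZl oe lj mulr0.
Qed.

Section Gram.
Variables A B : 'M[R[i]]_N.
Hypothesis gram0 : sprod A A * sprod B B - sprod A B ^+ 2 != 0.

(** Pairing the combination with [A] and [B] gives a homogeneous linear system whose matrix is the
    Gram matrix. *)
Lemma gram_free (c d : R) : sprod (c%:C *: A + d%:C *: B) A = 0 ->
  sprod (c%:C *: A + d%:C *: B) B = 0 -> c = 0 /\ d = 0.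
Proof.
rewrite !sprodDl !sprodZl (sprodC B A); exact: (cramer2_uniq gram0).
Qed.

Lemma gram_residual V :
  let det := sprod A A * sprod B B - sprod A B ^+ 2 in
  let a := (sprod B B * sprod V A - sprod A B * sprod V B) / det in
  let b := (sprod A A * sprod V B - sprod A B * sprod V A) / det in
  let W := V - a%:C *: A - b%:C *: B in
  sprod W A = 0 /\ sprod W B = 0.
Proof.
by rewrite /= !sprodBl !sprodZl (sprodC B A); exact: (cramer2_sol gram0).
Qed.

End Gram.

End ScalarProduct.

(* [Defs.normal_space] is qualified: the unqualified name refers to the
   separation axiom of MathComp-Analysis. *)
Section NormalPart.
Variables (R : realType) (N : nat) (Z : 'rV[R]_2 -> 'M[R[i]]_N) (x : 'rV[R]_2).
Hypothesis det0 : det_metric Z x != 0.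

(** Two candidates for the normal part differ by a vector that is both tangent and normal, hence
    zero since the Gram determinant does not vanish. The choice made by [xget] is therefore
    determined by any one decomposition. *)
Lemma normal_part_unique V W (a b : R) : Defs.normal_space Z x W ->
  V - W = a%:C *: pd xL Z x + b%:C *: pd xR Z x -> normal_part Z x V = W.
Proof.
move=> nW VW; apply: xget_unique; first by split => //; exists a, b.
move=> W' [[_ nW'] [a' [b' VW']]].
have eW : W' = W + ((a - a')%:C *: pd xL Z x + (b - b')%:C *: pd xR Z x).
  rewrite !rmorphB /= !scalerBl addrACA -opprD -VW -VW'.
  by rewrite opprB (addrC (V - W)) subrKA addrC subrK.
have nE D : sprod ((a - a')%:C *: pd xL Z x + (b - b')%:C *: pd xR Z x) (pd D Z x) = 0.
  by have := nW' D; rewrite eW sprodDl; case: nW => _ ->; rewrite add0r.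
have [ea eb] := gram_free det0 (nE xL) (nE xR).
by rewrite eW ea eb !rmorph0 !scale0r !addr0.
Qed.

Hypothesis suD : forall B, su (pd B Z x).

(** The coefficients [a] and [b] are the Cramer solution that makes the residual orthogonal to both
    tangent vectors; for [V] equal to Z_LL or Z_RR they are the coefficients A of the theorem. *)
Lemma normal_part_su V : su V ->
  let JL := metric Z xL xL x in
  let JR := metric Z xR xR x in
  let G := metric Z xL xR x in
  let a := (JR * sprod V (pd xL Z x) - G * sprod V (pd xR Z x)) / det_metric Z x in
  let b := (JL * sprod V (pd xR Z x) - G * sprod V (pd xL Z x)) / det_metric Z x in
  let W := V - a%:C *: pd xL Z x - b%:C *: pd xR Z x in
  normal_part Z x V = W /\ Defs.normal_space Z x W.
Proof.
move=> sV JL JR G a b W.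
suff nW : Defs.normal_space Z x W.
  split => //; apply: (normal_part_unique (a := a) (b := b)) => //.
  by rewrite /W -addrA -opprD opprB addrC subrK.
split; first by do 2![apply: suB; last exact: suZ].
have [WL WR] := gram_residual det0 V.
by case; [exact: WL|exact: WR].
Qed.

Lemma normal_part_id V : Defs.normal_space Z x V -> normal_part Z x V = V.
Proof.
by move=> nV; apply: (normal_part_unique (a := 0) (b := 0)) => //; rewrite !scale0r subrr addr0.
Qed.

Lemma normal_part_sum k (e : 'I_k -> 'M[R[i]]_N) V :
  orthonormal_normal_basis Z x e -> su V ->
  normal_part Z x V = \sum_j (sprod V (e j))%:C *: e j.
Proof.
move=> [ne oe ge] sV; have [-> nW] := normal_part_su sV.
set W := (X in X = _); have [c Wc] := ge W nW.
rewrite Wc; apply: eq_bigr => j _; congr (_%:C *: _).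
(* The coefficient is first read off as the product of the residual with [e j]; the tangential terms
   then drop out because [e j] is normal, leaving [V] itself. *)
rewrite -(sprod_orthonormal c j oe) -Wc.
by apply: sprod_residual; have [_] := ne j; apply.
Qed.

End NormalPart.

(** * Both curvature formulas in terms of given normal parts *)

Section CurvatureOfNormalParts.
Variables (R : realType) (N : nat) (Z : 'rV[R]_2 -> 'M[R[i]]_N) (x : 'rV[R]_2).
Variables WLL WLR WRR : 'M[R[i]]_N.
Hypothesis eLL : normal_part Z x (pd xL (pd xL Z) x) = WLL.
Hypothesis eLR : normal_part Z x (pd xL (pd xR Z) x) = WLR.
Hypothesis eRR : normal_part Z x (pd xR (pd xR Z) x) = WRR.

Lemma second_form_normal_part v : second_form Z x v =
  (dxi xL v ^+ 2)%:C *: WLL + (2 * (dxi xL v * dxi xR v))%:C *: WLR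
  + (dxi xR v ^+ 2)%:C *: WRR.
Proof. by case: _ / eLL; case: _ / eLR; case: _ / eRR. Qed.

Lemma mean_curvature_normal_part : mean_curvature Z x =
  ((det_metric Z x)^-1)%:C *:
    ((metric Z xR xR x)%:C *: WLL - (2 * metric Z xL xR x)%:C *: WLR
     + (metric Z xL xL x)%:C *: WRR).
Proof. by case: _ / eLL; case: _ / eLR; case: _ / eRR. Qed.

End CurvatureOfNormalParts.

Lemma scaler_sum3 (R : realType) N k (e : 'I_k -> 'M[R[i]]_N) (a b c : R)
    (f g h : 'I_k -> R) :
  a%:C *: (\sum_j (f j)%:C *: e j) + b%:C *: (\sum_j (g j)%:C *: e j)
    + c%:C *: (\sum_j (h j)%:C *: e j) =
  \sum_j (a * f j + b * g j + c * h j)%:C *: e j.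
Proof.
rewrite !scaler_sumr -!big_split /=; apply: eq_bigr => j _.
by rewrite !scalerA -!scalerDl !rmorphD !rmorphM.
Qed.

(** * The surface of a solution *)

Lemma has_pd_open (R : realType) p q (A : set 'rV[R]_2) B x
    (F G : 'rV[R]_2 -> 'M[R[i]]_(p, q)) F' :
  open A -> A x -> (forall y, A y -> F y = G y) -> has_pd B F x F' ->
  has_pd B G x F'.
Proof.
move=> oA Ax FG; apply: has_pd_near.
by apply: filterS (open_nbhs_nbhs (conj oA Ax)) => y; exact: FG.
Qed.

Lemma has_pd_commutator (R : realType) N B x
    (F G : 'rV[R]_2 -> 'M[R[i]]_N) F' G' : has_pd B F x F' -> has_pd B G x G' ->
  has_pd B (fun y => commutator_mx (F y) (G y)) x
    (commutator_mx F' (G x) + commutator_mx (F x) G').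
Proof.
move=> hF hG; have := has_pdB (has_pdM hF hG) (has_pdM hG hF).
congr has_pd.
by rewrite /commutator_mx opprD (addrC (- (G' *m F x))) addrACA.
Qed.

Section Surface.
Variables (R : realType) (m n : nat) (Omega : set 'rV[R]_2).
Variable X : 'rV[R]_2 -> 'M[R[i]]_(m + n, m).
Hypotheses (oO : open Omega) (sX : smooth_mx Omega X).
Hypothesis X1 : forall x, Omega x -> (X x)^t* *m X x = 1%:M.
Notation P := (perp_proj X).

Lemma perp_proj_idem x : Omega x -> P x *m P x = P x.
Proof.
move=> Ox; rewrite /perp_proj mulmxBr mulmx1 mulmxBl mul1mx mulmxA.
by rewrite -(mulmxA (X x) _ (X x)) X1 // mulmx1 subrr subr0.
Qed.

Lemma pd_trC D x : Omega x -> pd D (fun y => (X y)^t*) x = (pd D X x)^t*.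
Proof. by move=> Ox; apply: has_pdE; apply/has_pd_trC/(smooth_mx_has_pd D sX Ox). Qed.

(** The derivatives of the adjoint are known to be adjoints only on [Omega], so openness is needed
    to differentiate once more. *)
Lemma has_pd2_trC B D x : Omega x ->
  has_pd B (pd D (fun y => (X y)^t*)) x ((pd B (pd D X) x)^t*).
Proof.
move=> Ox; apply: (has_pd_open oO Ox (F := fun y => (pd D X y)^t*)).
  by move=> y Oy; rewrite pd_trC.
by apply/has_pd_trC/(smooth_mx_has_pd B (smooth_mx_pd D sX) Ox).
Qed.

Lemma has_pd_perp D x : Omega x -> has_pd D P x
  (- (pd D X x *m (X x)^t* + X x *m (pd D X x)^t*)).
Proof.
move=> Ox; have hX := smooth_mx_has_pd D sX Ox.
have := has_pdB (has_pd_cst D x 1%:M) (has_pdM hX (has_pd_trC hX)).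
by rewrite sub0r.
Qed.

Lemma has_pd2_perp B D x : Omega x -> has_pd B (pd D P) x
  (- (pd B (pd D X) x *m (X x)^t* + pd D X x *m (pd B X x)^t* +
      (pd B X x *m (pd D X x)^t* + X x *m (pd B (pd D X) x)^t*))).
Proof.
move=> Ox.
apply: (has_pd_open oO Ox
  (F := fun y => - (pd D X y *m (X y)^t* + X y *m (pd D X y)^t*))).
  by move=> y Oy; rewrite (has_pdE (has_pd_perp D Oy)).
have hX := smooth_mx_has_pd B sX Ox.
have hX2 := smooth_mx_has_pd B (smooth_mx_pd D sX) Ox.
apply: has_pdN; apply: has_pdD; first exact: has_pdM hX2 (has_pd_trC hX).
exact: has_pdM hX (has_pd_trC hX2).
Qed.

(** Both sides are the derivative of P^2 = P, which holds on the open set [Omega]. *)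
Lemma pd_perp_offdiag D x : Omega x ->
  pd D P x *m P x + P x *m pd D P x = pd D P x.
Proof.
move=> Ox; have hP := has_pdP (has_pd_perp D Ox).
rewrite -(has_pdE (has_pdM hP hP)).
apply: has_pdE; apply: (has_pd_open oO Ox) hP => y Oy.
by rewrite perp_proj_idem.
Qed.

Lemma pd_gram D x : Omega x ->
  (pd D X x)^t* *m X x + (X x)^t* *m pd D X x = 0.
Proof.
move=> Ox; have hX := smooth_mx_has_pd D sX Ox.
rewrite -(has_pdE (has_pdM (has_pd_trC hX) hX)); apply: has_pdE.
apply: (has_pd_open oO Ox) (has_pd_cst D x 1%:M) => y Oy.
by rewrite X1.
Qed.

Variable Z : 'rV[R]_2 -> 'M[R[i]]_(m + n).
Hypothesis hZ : surface Omega X Z.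

(** The sign [(-1) ^+ (~~ D)] is 1 for [xL] and -1 for [xR], which lets both surface equations be
    treated at once. *)
Lemma pd_surface D x : Omega x ->
  pd D Z x = (-1) ^+ (~~ D) *: commutator_mx (pd D P x) (P x).
Proof.
have [_ _ hL hR] := hZ; case: D => Ox; first by rewrite expr0 scale1r; exact: hL.
by rewrite expr1 scaleN1r; exact: hR.
Qed.

(** For [B = D] the second commutator is zero; for Z_LR the field equation removes the first. *)
Lemma pd2_surface B D x : Omega x -> pd B (pd D Z) x = (-1) ^+ (~~ D) *:
  (commutator_mx (pd B (pd D P) x) (P x) + commutator_mx (pd D P x) (pd B P x)).
Proof.
move=> Ox; have hC := has_pd_commutator (has_pdP (has_pd2_perp B D Ox))
                                        (has_pdP (has_pd_perp B Ox)).
apply: has_pdE; apply: (has_pd_open oO Ox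
  (F := fun y => (-1) ^+ (~~ D) *: commutator_mx (pd D P y) (P y))).
  by move=> y Oy; rewrite (pd_surface D Oy).
case: D hC => hC /=; first by under eq_fun do rewrite scale1r; rewrite scale1r.
by under eq_fun do rewrite expr1 scaleN1r; rewrite expr1 scaleN1r; exact: has_pdN.
Qed.

Lemma su_pd_surface D x : Omega x -> su (pd D Z x).
Proof.
have [sZ suZ _ _] := hZ; move=> Ox.
apply: (su_pd (Z := Z) (B := D) (x := x)); last exact: smooth_mx_has_pd sZ Ox.
by apply: filterS (open_nbhs_nbhs (conj oO Ox)) => y; exact: suZ.
Qed.

Lemma su_pd2_surface B D x : Omega x -> su (pd B (pd D Z) x).
Proof.
have [sZ _ _ _] := hZ; move=> Ox.
apply: (su_pd (Z := pd D Z) (B := B) (x := x)).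
  by apply: filterS (open_nbhs_nbhs (conj oO Ox)) => y; exact: su_pd_surface.
exact: smooth_mx_has_pd (smooth_mx_pd D sZ) Ox.
Qed.

Lemma sprod_pd2_surface B D x : Omega x ->
  (sprod (pd B (pd B Z) x) (pd D Z x))%:C =
  ((B == D)%:R - 2^-1) *
    \tr ((pd B (pd B X) x *m (pd D X x)^t* + pd D X x *m (pd B (pd B X) x)^t*) *m P x
         + 2 *: (pd B X x *m (pd B X x)^t*
                 *m (X x *m (pd D X x)^t* + pd D X x *m (X x)^t*))).
Proof.
move=> Ox; rewrite sprodE; [|exact: su_pd2_surface|exact: su_pd_surface].
rewrite pd2_surface // pd_surface //.
rewrite [X in _ + X](_ : _ = 0) ?addr0; last by rewrite /commutator_mx subrr.
rewrite -scalemxAl -scalemxAr !linearZ /= tr_commutator_proj; last 2 first.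
- exact: perp_proj_idem.
- exact: pd_perp_offdiag.
rewrite (has_pdE (has_pd2_perp B B Ox)) (has_pdE (has_pd_perp D Ox)).
rewrite mulNmx mulmxN opprK (tr_perp_der2 _ _ _ _ (X1 Ox) (pd_gram D Ox)).
rewrite -/(perp_proj X x) !mulrA; set t := \tr _.
(* The product of the two signs with 1/2 must equal delta_BD - 1/2. Naming 1/2 as [a], with 1 - [a]
   = [a], reduces this to four sign checks. *)
have h : 1 - 2^-1 = 2^-1 :> R[i] by rewrite [X in X - _]splitr mul1r addrK.
move: (2^-1) h => a h.
by case: (B); case: (D); rewrite /= ?h ?sub0r ?expr0 ?expr1 ?(mulr1, mul1r, mulrN, mulNr, opprK).
Qed.

Lemma normal_space_pd_LR x : Omega x ->
  commutator_mx (pd xL (pd xR P) x) (P x) = 0 ->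
  Defs.normal_space Z x (pd xL (pd xR Z) x).
Proof.
move=> Ox sol; split => [|D]; first exact: su_pd2_surface.
rewrite /sprod pd2_surface // sol add0r (pd_surface D) //.
rewrite -scalemxAl -scalemxAr !linearZ /= tr_commutator_der_proj ?mulr0 //.
- exact: pd_perp_offdiag.
- exact: pd_perp_offdiag.
Qed.

End Surface.

Theorem mainTheorem5 (R : realType) (m n : nat) (hm : (0 < m)%N) (hn : (0 < n)%N)
  (Omega : set 'rV[R]_2) (hopen : open Omega) (hconn : connected Omega)
  (hsimply : simply_connected R Omega)
  (X : 'rV[R]_2 -> 'M[R[i]]_(m + n, m)) (hX : sigma_solution Omega X)
  (Z : 'rV[R]_2 -> 'M[R[i]]_(m + n)) (hZ : surface Omega X Z)
  (x0 : 'rV[R]_2) (hx0 : Omega x0)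
  (U : set 'rV[R]_2) (hU : nbhs x0 U) (hUO : U `<=` Omega)
  (hdet : forall x, U x -> det_metric Z x != 0) :
  forall x, U x ->
  let Xd := fun y => (X y)^t* in
  let P := perp_proj X x in
  let ZL := pd xL Z x in
  let ZR := pd xR Z x in
  let ZLL := pd xL (pd xL Z) x in
  let ZLR := pd xL (pd xR Z) x in
  let ZRR := pd xR (pd xR Z) x in
  let JL := metric Z xL xL x in
  let JR := metric Z xR xR x in
  let GLR := metric Z xL xR x in
  let detG := det_metric Z x in
  let ALL := (JR * sprod ZLL ZL - GLR * sprod ZLL ZR) / detG in
  let ALR := (JL * sprod ZLL ZR - GLR * sprod ZLL ZL) / detG in
  let ARR := (JL * sprod ZRR ZR - GLR * sprod ZRR ZL) / detG in
  let ARL := (JR * sprod ZRR ZL - GLR * sprod ZRR ZR) / detG in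
  [/\ forall v : 'rV[R]_2,
        second_form Z x v =
          (dxi xL v ^+ 2)%:C *: (ZLL - ALL%:C *: ZL - ALR%:C *: ZR)
          + (2 * (dxi xL v * dxi xR v))%:C *: ZLR
          + (dxi xR v ^+ 2)%:C *: (ZRR - ARL%:C *: ZL - ARR%:C *: ZR),
      mean_curvature Z x =
        (detG^-1)%:C *:
          (JR%:C *: (ZLL - ALL%:C *: ZL - ALR%:C *: ZR)
           - (2 * GLR)%:C *: ZLR
           + JL%:C *: (ZRR - ARL%:C *: ZL - ARR%:C *: ZR)),
      forall B D : bool,
        (sprod (pd B (pd B Z) x) (pd D Z x))%:C =
          ((B == D)%:R - 2^-1) *
            \tr ((pd B (pd B X) x *m pd D Xd x
                  + pd D X x *m pd B (pd B Xd) x) *m P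
                 + 2 *: (pd B X x *m pd B Xd x
                         *m (X x *m pd D Xd x + pd D X x *m Xd x)))
    & forall e : 'I_((m + n) ^ 2 - 3) -> 'M[R[i]]_(m + n),
        orthonormal_normal_basis Z x e ->
        let QL := fun j => sprod ZLL (e j) in
        let H := fun j => sprod ZLR (e j) in
        let QR := fun j => sprod ZRR (e j) in
        (forall v : 'rV[R]_2,
           second_form Z x v =
             \sum_j (QL j * dxi xL v ^+ 2 + 2 * H j * (dxi xL v * dxi xR v)
                     + QR j * dxi xR v ^+ 2)%:C *: e j) /\
        mean_curvature Z x =
          (detG^-1)%:C *:
            \sum_j (JR * QL j - 2 * GLR * H j + JL * QR j)%:C *: e j].
Proof.
move=> x Ux; have Ox := hUO x Ux; have det0 := hdet x Ux.
have [sX X1 sol] := hX.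
have suD B := su_pd_surface hopen hZ B Ox.
have suDD B D := su_pd2_surface hopen hZ B D Ox.
move=> Xd P ZL ZR ZLL ZLR ZRR JL JR GLR detG ALL ALR ARR ARL.
have [eLL _] := normal_part_su det0 suD (suDD xL xL).
have [eRR _] := normal_part_su det0 suD (suDD xR xR).
(* The field equation enters here: the mixed derivative is its own normal part, so its term carries
   no tangential correction. *)
have eLR := normal_part_id det0 (normal_space_pd_LR hopen sX X1 hZ Ox (sol x Ox)).
split.
- exact: (second_form_normal_part eLL eLR eRR).
- exact: (mean_curvature_normal_part eLL eLR eRR).
- move=> B D; rewrite /Xd (pd_trC sX D Ox) (pd_trC sX B Ox).
  rewrite (has_pdE (has_pd2_trC hopen sX B B Ox)).
  exact: (sprod_pd2_surface hopen sX X1 hZ).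
move=> e he QL H QR.
(* The same curvature formulas are now fed with the orthonormal expansions of the three normal
   parts. *)
have nE B D := normal_part_sum det0 suD he (suDD B D).
split=> [v|].
  apply: etrans (second_form_normal_part (nE _ _) (nE _ _) (nE _ _) v) _.
  rewrite scaler_sum3; apply: eq_bigr => j _; congr (_%:C *: _).
  by congr (_ + _ + _); [exact: mulrC | exact: mulrAC | exact: mulrC].
apply: etrans (mean_curvature_normal_part (nE _ _) (nE _ _) (nE _ _)) _.
(* The minus sign of the mixed term is absorbed into its coefficient to match the sum of three terms
   in [scaler_sum3]. *)
congr (_ *: _); rewrite -scaleNr -rmorphN scaler_sum3; apply: eq_bigr => j _.
by congr (_%:C *: _); congr (_ + _ + _); exact: mulNr.
Qed.
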